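(* Let $k$ be an algebraically closed field, let $\mathcal{A}$ be a spectroid over $k$, and let $0 \to L \to M \to N \to 0$ be an almost split sequence in $\operatorname{mod}\mathcal{A}$, the category of locally finite dimensional $\mathcal{A}$-modules. Then $L$ is finitely co-presented and $N$ is finitely presented.
   Context: $k$ is an algebraically closed field; all categories are preadditive $k$-categories. A spectroid is a Hom-finite $k$-category $\mathcal{A}$ (all Hom spaces are finite dimensional over $k$) in which all objects have local endomorphism algebras and distinct objects are not isomorphic. $\operatorname{Mod}\mathcal{A}$ is the category of all $k$-linear covariant functors from $\mathcal{A}$ to $k$-vector spaces, and $\operatorname{mod}\mathcal{A}$ is its full subcategory of functors with values in finite dimensional $k$-vector spaces (locally finite dimensional modules). For an object $a$ of $\mathcal{A}$, put $P_a=\operatorname{Hom}_{\mathcal{A}}(a,-)$ and $I_a=D\operatorname{Hom}_{\mathcal{A}}(-,a)$, with $D=\operatorname{Hom}_k(-,k)$ applied pointwise. A module $M$ is finitely generated if there is an epimorphism $\bigoplus_{i=1}^r P_{a_i}\to M$ for finitely many objects $a_1,\dots,a_r$, and finitely presented if moreover the kernel of this epimorphism is finitely generated. Dually, $M$ is finitely co-generated if there is a monomorphism $M\to\bigoplus_{i=1}^s I_{b_i}$ for finitely many objects $b_1,\dots,b_s$, and finitely co-presented if moreover the cokernel of this monomorphism is finitely co-generated. An almost split sequence in $\operatorname{mod}\mathcal{A}$ is a non-split short exact sequence $0\to L\xrightarrow{f} M\xrightarrow{g} N\to 0$ with $L,N$ indecomposable such that every morphism $L\to X$ in $\operatorname{mod}\mathcal{A}$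 that is not a section factors through $f$ and every morphism $X\to N$ in $\operatorname{mod}\mathcal{A}$ that is not a retraction factors through $g$. *)

(* Defs.v *)
From HB Require Import structures.
From mathcomp Require Import all_boot all_algebra.

Set Implicit Arguments.
Unset Strict Implicit.
Unset Printing Implicit Defensive.

Import GRing.Theory.
Local Open Scope ring_scope.

(* Finite dimensionality of a k-vector space is encoded by vectType k, so the
   Hom spaces below are finite dimensional by construction. *)
Record homFinCat (k : fieldType) := HomFinCat {
  Ob :> Type;
  Hom : Ob -> Ob -> vectType k;
  idm : forall a, Hom a a;
  (* comp g f is "g after f" *)
  comp : forall a b c, Hom b c -> Hom a b -> Hom a c;
  comp_linearl : forall a b c (f : Hom a b), linear (fun g : Hom b c => comp g f);
  comp_linearr : forall a b c (g : Hom b c), linear (fun f : Hom a b => comp g f);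
  compA : forall a b c d (h : Hom c d) (g : Hom b c) (f : Hom a b),
    comp h (comp g f) = comp (comp h g) f;
  comp1m : forall a b (f : Hom a b), comp (idm b) f = f;
  compm1 : forall a b (f : Hom a b), comp f (idm a) = f
}.

Arguments Hom {k} A a b : rename.
Arguments idm {k A} a : rename.
Arguments comp {k A a b c} g f : rename.

Section Category.
Variables (k : fieldType) (A : homFinCat k).

Definition is_iso (a b : A) (f : Hom A a b) : Prop :=
  exists g : Hom A b a, comp g f = idm a /\ comp f g = idm b.

Definition isomorphic (a b : A) : Prop := exists f : Hom A a b, is_iso f.

(* End(a) is a local ring: it is nonzero and its non-units are closed under
   addition. *)
Definition local_end (a : A) : Prop :=
  idm a <> 0 /\
  forall f g : Hom A a a, ~ is_iso f -> ~ is_iso g -> ~ is_iso (f + g).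

End Category.

Record spectroid (k : fieldType) := Spectroid {
  spectroid_cat :> homFinCat k;
  spectroid_local : forall a : spectroid_cat, local_end a;
  spectroid_skeletal : forall a b : spectroid_cat, isomorphic a b -> a = b
}.

(* The objects of mod A: k-linear covariant functors from A to finite
   dimensional vector spaces. *)
Record lfdMod (k : fieldType) (A : homFinCat k) := LfdMod {
  mob :> A -> vectType k;
  mact : forall a b, Hom A a b -> 'Hom(mob a, mob b);
  mact_linear : forall a b, linear (@mact a b);
  mact1 : forall a, mact (idm a) = \1%VF;
  mactM : forall a b c (g : Hom A b c) (f : Hom A a b),
    mact (comp g f) = (mact g \o mact f)%VF
}.

Arguments mact {k A} M {a b} h : rename.

Record mor (k : fieldType) (A : homFinCat k) (M N : lfdMod A) := Mor {
  mfun :> forall a, 'Hom(M a, N a);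
  mnat : forall a b (h : Hom A a b),
    (mact N h \o mfun a)%VF = (mfun b \o mact M h)%VF
}.

Lemma linfunE_of (k : fieldType) (U V : vectType k) (f : U -> V) :
  linear f -> linfun f =1 f.
Proof.
move=> fL; pose L := GRing.isLinear.Build k U V *:%R f fL.
pose F : {linear U -> V} := HB.pack f L.
exact: (lfunE F).
Qed.

Section Modules.
Variables (k : fieldType) (A : homFinCat k).

Section Projective.
Variable a : A.

Definition proj_act (b c : A) (h : Hom A b c) : 'Hom(Hom A a b, Hom A a c) :=
  linfun (fun f : Hom A a b => comp h f).

Fact proj_actE b c (h : Hom A b c) f : proj_act h f = comp h f.
Proof. exact: linfunE_of (comp_linearr h) f. Qed.

Fact proj_act_linear b c : linear (@proj_act b c).
Proof.
move=> t g h; apply/lfunP => f.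
by rewrite add_lfunE scale_lfunE !proj_actE (comp_linearl f t g h).
Qed.

Fact proj_act1 b : proj_act (idm b) = \1%VF.
Proof. by apply/lfunP => f; rewrite proj_actE comp1m id_lfunE. Qed.

Fact proj_actM b c d (g : Hom A c d) (f : Hom A b c) :
  proj_act (comp g f) = (proj_act g \o proj_act f)%VF.
Proof. by apply/lfunP => u; rewrite comp_lfunE !proj_actE compA. Qed.

(* P_a = Hom(a, -) *)
Definition proj : lfdMod A := LfdMod proj_act_linear proj_act1 proj_actM.

End Projective.

Section Injective.
Variable a : A.

Definition dual (V : vectType k) : vectType k := 'Hom(V, k^o).

Definition precomp (b c : A) (h : Hom A b c) : 'Hom(Hom A c a, Hom A b a) :=
  linfun (fun g : Hom A c a => comp g h).

Definition inj_act (b c : A) (h : Hom A b c) :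
    'Hom(dual (Hom A b a), dual (Hom A c a)) :=
  linfun (fun u : dual (Hom A b a) => (u \o precomp h)%VF : dual (Hom A c a)).

Fact precompE b c (h : Hom A b c) g : precomp h g = comp g h.
Proof. exact: linfunE_of (comp_linearl h) g. Qed.

Fact inj_actE b c (h : Hom A b c) u : inj_act h u = (u \o precomp h)%VF.
Proof.
apply: (@linfunE_of _ (dual (Hom A b a)) (dual (Hom A c a))) => t v w.
by apply/lfunP => x; rewrite !(add_lfunE, scale_lfunE, comp_lfunE).
Qed.

Fact inj_act_linear b c : linear (@inj_act b c).
Proof.
move=> t g h; apply/lfunP => u; rewrite add_lfunE scale_lfunE !inj_actE.
apply/lfunP => x; rewrite add_lfunE scale_lfunE !comp_lfunE !precompE.
by rewrite (comp_linearr x t g h) linearP.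
Qed.

Fact inj_act1 b : inj_act (idm b) = \1%VF.
Proof.
apply/lfunP => u; rewrite inj_actE id_lfunE; apply/lfunP => x.
by rewrite comp_lfunE precompE compm1.
Qed.

Fact inj_actM b c d (g : Hom A c d) (f : Hom A b c) :
  inj_act (comp g f) = (inj_act g \o inj_act f)%VF.
Proof.
apply/lfunP => u; rewrite comp_lfunE !inj_actE; apply/lfunP => x.
by rewrite !comp_lfunE !precompE compA.
Qed.

(* I_a = D Hom(-, a) *)
Definition inj : lfdMod A := LfdMod inj_act_linear inj_act1 inj_actM.

End Injective.

Section DirectSum.
Variables M N : lfdMod A.

Definition dsum_ob (a : A) : vectType k := (M a * N a)%type.

Definition dsum_act (a b : A) (h : Hom A a b) : 'Hom(dsum_ob a, dsum_ob b) :=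
  linfun (fun x : dsum_ob a => (mact M h x.1, mact N h x.2) : dsum_ob b).

Fact dsum_actE a b (h : Hom A a b) x :
  dsum_act h x = (mact M h x.1, mact N h x.2).
Proof.
apply: (@linfunE_of _ (dsum_ob a) (dsum_ob b)) => t u v.
by congr (_, _); rewrite /= linearP.
Qed.

Fact dsum_act_linear a b : linear (@dsum_act a b).
Proof.
move=> t g h; apply/lfunP => x; rewrite add_lfunE scale_lfunE !dsum_actE.
by congr (_, _); rewrite mact_linear add_lfunE scale_lfunE.
Qed.

Fact dsum_act1 a : dsum_act (idm a) = \1%VF.
Proof.
by apply/lfunP => -[x y]; rewrite dsum_actE !mact1 !id_lfunE.
Qed.

Fact dsum_actM a b c (g : Hom A b c) (f : Hom A a b) :
  dsum_act (comp g f) = (dsum_act g \o dsum_act f)%VF.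
Proof.
by apply/lfunP => x; rewrite comp_lfunE !dsum_actE !mactM !comp_lfunE.
Qed.

Definition dsum : lfdMod A := LfdMod dsum_act_linear dsum_act1 dsum_actM.

End DirectSum.

Definition zero_ob (a : A) : vectType k := 'rV[k]_0.
Definition zero_act (a b : A) (h : Hom A a b) : 'Hom(zero_ob a, zero_ob b) := 0.

Fact zero_act_linear a b : linear (@zero_act a b).
Proof. by move=> t g h; rewrite /zero_act scaler0 addr0. Qed.

Fact zero_act1 a : zero_act (idm a) = \1%VF.
Proof. by apply/lfunP => x; apply/rowP => -[]. Qed.

Fact zero_actM a b c (g : Hom A b c) (f : Hom A a b) :
  zero_act (comp g f) = (zero_act g \o zero_act f)%VF.
Proof. by apply/lfunP => x; apply/rowP => -[]. Qed.

Definition zero_mod : lfdMod A := LfdMod zero_act_linear zero_act1 zero_actM.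

Definition bigdsum (s : seq (lfdMod A)) : lfdMod A := foldr dsum zero_mod s.

Definition is_mono (M N : lfdMod A) (f : mor M N) : Prop :=
  forall a, lker (f a) = 0%VS.

Definition is_epi (M N : lfdMod A) (f : mor M N) : Prop :=
  forall a, limg (f a) = fullv.

Definition short_exact (L M N : lfdMod A) (f : mor L M) (g : mor M N) : Prop :=
  [/\ is_mono f, forall a, limg (f a) = lker (g a) & is_epi g].

Definition is_section (M N : lfdMod A) (f : mor M N) : Prop :=
  exists r : mor N M, forall a, (r a \o f a)%VF = \1%VF.

Definition is_retraction (M N : lfdMod A) (g : mor M N) : Prop :=
  exists s : mor N M, forall a, (g a \o s a)%VF = \1%VF.

Definition mod_iso (M N : lfdMod A) : Prop :=
  exists (f : mor M N) (g : mor N M),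
    forall a, (g a \o f a)%VF = \1%VF /\ (f a \o g a)%VF = \1%VF.

Definition is_zero (M : lfdMod A) : Prop := forall a (x : M a), x = 0.

Definition indecomposable (M : lfdMod A) : Prop :=
  ~ is_zero M /\
  forall X Y : lfdMod A, mod_iso M (dsum X Y) -> is_zero X \/ is_zero Y.

Definition almost_split (L M N : lfdMod A) (f : mor L M) (g : mor M N) : Prop :=
  [/\ short_exact f g,
      ~ is_retraction g, (* a short exact sequence splits iff g is a retraction *)
      indecomposable L /\ indecomposable N,
      forall (X : lfdMod A) (u : mor L X), ~ is_section u ->
        exists v : mor M X, forall a, u a = (v a \o f a)%VF
    & forall (X : lfdMod A) (u : mor X N), ~ is_retraction u ->
        exists v : mor X M, forall a, u a = (g a \o v a)%VF].

Definition finitely_generated (M : lfdMod A) : Prop :=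
  exists (s : seq A) (p : mor (bigdsum (map proj s)) M), is_epi p.

(* The kernel of p is given, up to isomorphism, by a short exact sequence
   0 -> K -> P -> M -> 0; dually for cokernels below. *)
Definition finitely_presented (M : lfdMod A) : Prop :=
  exists (s : seq A) (p : mor (bigdsum (map proj s)) M)
         (K : lfdMod A) (i : mor K (bigdsum (map proj s))),
    short_exact i p /\ finitely_generated K.

Definition finitely_cogenerated (M : lfdMod A) : Prop :=
  exists (s : seq A) (i : mor M (bigdsum (map inj s))), is_mono i.

Definition finitely_copresented (M : lfdMod A) : Prop :=
  exists (s : seq A) (i : mor M (bigdsum (map inj s)))
         (C : lfdMod A) (q : mor (bigdsum (map inj s)) C),
    short_exact i q /\ finitely_cogenerated C.

End Modules.

(* Main.v *)
From mathcomp Require Import all_boot all_algebra.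
From mathcomp Require Import boolp classical_sets.
From Stdlib Require Import List.
Require Import Defs.

Set Implicit Arguments.
Unset Strict Implicit.
Unset Printing Implicit Defensive.

Import GRing.Theory.
Local Open Scope ring_scope.

(** The finiteness of [N] comes from a finite set [F] of objects that detects it.

    Consider families of linear sections of [g a : M a -> N a], indexed by the
    objects [a], that commute with the actions of the morphisms. Each of these
    conditions is affine and involves at most two objects, and all the unknowns
    lie in finite dimensional spaces. By linear compactness
    ([affine_compactness], in the form [local_morphisms_glue]) such a family
    exists as soon as the conditions over each finite set of objects can be
    satisfied. As [g] does not split, there is a finite [F] over which they
    cannot. If now [u : X -> N] is bijective on [F], then [u] is a retraction:
    otherwise [u = g v] and the maps [v a \o (u a)^-1], for [a] in [F], satisfy
    the conditions over [F] ([retraction_detected]).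

    This property is applied to two modules. The submodule of [N] generated by
    the values of [N] on [F] has an inclusion that is bijective on [F], so the
    inclusion is onto and there is an epimorphism [p : P -> N] from a finite sum
    of representables [P_a] with [a] in [F]. Let [K'] be the submodule of [P]
    generated by the values of [ker p] on [F]; then [P / K' -> N] is bijective
    on [F], so it has a section [r]. The projection [P -> P / K'] and [r p] agree
    on [F], and [P] is generated by its values on [F], so they are equal. Hence
    [ker p = K'] is generated by its values on [F], and [N] is finitely
    presented ([finitely_presented_of_detected]).

    The argument for [L] is dual: [f] is not a section, a finite [F] detects
    sections [L -> X], and submodules generated by values on [F] are replaced by
    the largest submodules with prescribed values on [F]. *)

(** * Compactness for affine conditions on finite dimensional spaces *)

Section LinearAlgebra.
Variables (k : fieldType) (V : vectType k).

(** A subspace of largest dimension among those on which [D] holds contains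
    every vector satisfying [D], since adding one would raise the dimension. *)
Lemma vspace_of_pred (D : V -> Prop) :
  D 0 -> (forall t x y, D x -> D y -> D (t *: x + y)) ->
  exists U : {vspace V}, forall x, x \in U <-> D x.
Proof.
move=> D0 Dlin.
pose Q n := `[< exists U : {vspace V}, (forall x, x \in U -> D x) /\ \dim U = n >].
have exQ : exists n, Q n.
  exists 0%N; apply/asboolP; exists 0%VS; split; last exact: dimv0.
  by move=> x; rewrite memv0 => /eqP ->.
have ubQ n : Q n -> (n <= \dim {:V})%N.
  by move=> /asboolP[U [_ <-]]; apply/dimvS/subvf.
case: (ex_maxnP exQ ubQ) => n /asboolP[U [UD dimU]] maxU.
exists U => x; split; [exact: UD | move=> Dx].
have sUx : (U <= U + <[x]>)%VS by exact: addvSl.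
have : (U == U + <[x]>)%VS.
  rewrite eqEdim sUx dimU; apply: maxU; apply/asboolP; exists (U + <[x]>)%VS.
  split=> // y /memv_addP[u uU [v /vlineP[t ->] ->]].
  by rewrite addrC; apply/Dlin/UD.
by move=> /eqP ->; apply/(subvP (addvSr _ _))/memv_line.
Qed.

Definition affine (T : V -> Prop) : Prop :=
  forall x y z t, T x -> T y -> T z -> T (x + t *: (y - z)).

(** A nonempty affine set contained in another one with the same direction is
    equal to it. So a member whose direction has least dimension is equal to
    every member that it contains, and by directedness it lies in all of them. *)
Lemma affine_directed_least (J : Type) (j0 : J) (T : J -> V -> Prop) :
    (forall j, exists x, T j x) -> (forall j, affine (T j)) ->
    (forall i j, exists l, forall x, T l x -> T i x /\ T j x) ->
  exists j, forall i x, T j x -> T i x.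
Proof.
move=> Tne Taff Tdir.
pose dir j (x : V) := exists y z, [/\ T j y, T j z & x = y - z].
have dirV j : exists U : {vspace V}, forall x, x \in U <-> dir j x.
  apply: vspace_of_pred => [|t x y [x1 [x2 [Tx1 Tx2 ->]]] [y1 [y2 [Ty1 Ty2 ->]]]].
    by have [x Tx] := Tne j; exists x, x; rewrite subrr.
  exists (y1 + t *: (x1 - x2)), y2; split=> //; first exact: Taff.
  by rewrite addrA (addrC _ y1).
have [U UP] := choice dirV.
pose Q n := `[< exists j, \dim (U j) = n >].
have exQ : exists n, Q n by exists (\dim (U j0)); apply/asboolP; exists j0.
case: (ex_minnP exQ) => n /asboolP[j dimj] minj; exists j => i x Tjx.
have [l lP] := Tdir j i; have [z Tlz] := Tne l.
have Ulj : (U l == U j)%VS.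
  rewrite eqEdim dimj minj ?andbT; last by apply/asboolP; exists l.
  apply/subvP => y /UP[y1 [y2 [/lP[Ty1 _] /lP[Ty2 _] ->]]].
  by apply/UP; exists y1, y2.
have : x - z \in U l.
  by rewrite (eqP Ulj); apply/UP; exists x, z; split=> //; have [] := lP z Tlz.
move=> /UP[y1 [y2 [Ty1 Ty2 exz]]].
have -> : x = z + 1 *: (y1 - y2) by rewrite scale1r -exz addrC subrK.
by have [] := lP _ (Taff l _ _ _ 1 Tlz Ty1 Ty2).
Qed.

End LinearAlgebra.

(** Linear compactness of a product of finite dimensional spaces. A maximal
    partial assignment among those that can be extended to a solution of every
    finite subsystem is total. Indeed, at a further index, each finite subsystem
    leaves a nonempty affine set of possible values; these sets are directed, so
    they have a common point, by which the assignment can be extended. *)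
Lemma affine_compactness (k : fieldType) (I : Type) (V : I -> vectType k)
    (P : list I -> (forall i, V i) -> Prop) :
    (forall F x y z t, P F x -> P F y -> P F z ->
       P F (fun i => x i + t *: (y i - z i))) ->
    (forall F x y, (forall i, In i F -> x i = y i) -> P F x -> P F y) ->
    (forall F G x, incl F G -> P G x -> P F x) ->
    (forall F, exists x, P F x) ->
  exists x, forall F, P F x.
Proof.
move=> Paff Ploc Pmono Pne; pose T := {i : I & V i}.
pose compat (R : set T) F (y : forall i, V i) :=
  forall q : T, R q -> In (projT1 q) F -> y (projT1 q) = projT2 q.
pose ext (R : set T) := forall F, exists2 y, P F y & compat R F y.
have [C Cext Ctot | R [Rext Rmax]] := @Zorn_bigcup T ext.
  move=> F.
  have [[X0 CX0] | C0] := pselect (exists X, C X); last first.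
    by have [z Pz] := Pne F; exists z => // q [X CX]; case: C0; exists X.
  (* An extendable assignment is functional, so the union of the chain meets a
     finite set of indices in finitely many points, and these all lie in one
     member of the chain. *)
  have join X Y : C X -> C Y ->
      exists Z, [/\ C Z, (X `<=` Z)%classic & (Y `<=` Z)%classic].
    by move=> CX CY; have [? | ?] := Ctot X Y CX CY; [exists Y | exists X]; split.
  have [X CX XP] : exists2 X, C X & forall q : T,
      (\bigcup_(Y in C) Y)%classic q -> In (projT1 q) F -> X q.
    elim: F => [|i G [X CX XP]]; first by exists X0.
    have [[v [Y CY Yv]] | nv] :=
        pselect (exists v, (\bigcup_(Y in C) Y)%classic (existT V i v)).
      have [Z [CZ XZ YZ]] := join X Y CX CY.
      exists Z => // -[j w] [W CW Ww] /= [ij | jG]; last first.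
        by apply/XZ/XP => //; exists W.
      case: j / ij w Ww => w Ww.
      have [Z' [CZ' WZ' ZZ']] := join W Z CW CZ.
      have [y _ yP] := Cext _ CZ' [:: i].
      have := yP (existT V i w) (WZ' _ Ww) (or_introl erefl).
      have := yP (existT V i v) (ZZ' _ (YZ _ Yv)) (or_introl erefl).
      by move=> /= -> <-; apply: YZ.
    exists X => // -[j w] Uw /= [ij | jG]; last exact: XP.
    by case: nv; rewrite ij; exists w.
  have [y Py yP] := Cext X CX F.
  by exists y => // q Uq qF; apply: yP => //; apply: XP.
have total i : exists v, R (existT V i v).
  (* The values at [i] that the conditions over [F] and [i] leave possible. *)
  pose S F v := exists y, [/\ P (i :: F) y, compat R (i :: F) y & y i = v].
  have Smono F G v : incl F G -> S G v -> S F v.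
    move=> FG [y [Py yP yv]]; exists y.
    have iFG : incl (i :: F) (i :: G).
      by apply: incl_cons; [left | apply: incl_tl].
    by split=> //; [apply: Pmono Py | move=> q Rq /iFG; apply: yP].
  have Sne F : exists v, S F v.
    by have [y Py yP] := Rext (i :: F); exists (y i), y.
  have Saff F : affine (S F).
    move=> _ _ _ t [x [Px xP <-]] [y [Py yP <-]] [z [Pz zP <-]].
    exists (fun j => x j + t *: (y j - z j)); split=> //; first exact: Paff.
    by move=> q Rq qF; rewrite xP // yP // zP // subrr scaler0 addr0.
  have Sdir F G : exists H, forall v, S H v -> S F v /\ S G v.
    by exists (F ++ G) => v Sv; split; apply: Smono Sv;
      [apply: incl_appl | apply: incl_appr].
  have [F FP] := affine_directed_least nil Sne Saff Sdir.
  have [v Sv] := Sne F; exists v; apply: contrapT => Rv.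
  apply: (Rmax (R `|` [set existT V i v])%classic).
    split; first by move=> q; left.
    by move=> /(_ (existT V i v) (or_intror erefl)).
  move=> G; have [y [Py yP yv]] := FP G v Sv.
  have iG : incl G (i :: G) by apply: incl_tl.
  exists y; first exact: Pmono Py.
  by move=> q [Rq /iG | -> _]; [apply: yP | ].
pose x i := projT1 (cid (total i)).
have xR i : R (existT V i (x i)) := projT2 (cid (total i)).
exists x => F; have [y Py yP] := Rext F; apply: Ploc Py => i iF.
exact: yP (existT V i (x i)) (xR i) iF.
Qed.

(** * Submodules, quotients and morphisms *)

Section ModuleConstructions.
Variables (k : fieldType) (A : homFinCat k).
Implicit Types M N X Y : lfdMod A.

Lemma mnatE M N (u : mor M N) a b (h : Hom A a b) x :
  mact N h (u a x) = u b (mact M h x).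
Proof. by have /lfunP/(_ x) := mnat u h; rewrite !comp_lfunE. Qed.

Lemma mactME M a b c (h : Hom A b c) (h' : Hom A a b) x :
  mact M (comp h h') x = mact M h (mact M h' x).
Proof. by rewrite mactM comp_lfunE. Qed.

Lemma mact_lin M a b t (h h' : Hom A a b) x :
  mact M (t *: h + h') x = t *: mact M h x + mact M h' x.
Proof. by rewrite mact_linear add_lfunE scale_lfunE. Qed.

Lemma is_monoP M N (u : mor M N) :
  (forall a x, u a x = 0 -> x = 0) -> is_mono u.
Proof.
move=> u0 a; apply/eqP; rewrite -subv0; apply/subvP => x.
by rewrite memv_ker memv0 => /eqP/u0 ->.
Qed.

Lemma is_mono_eq0 M N (u : mor M N) a x : is_mono u -> u a x = 0 -> x = 0.
Proof. by move=> u0 ux; apply/eqP; rewrite -memv0 -(u0 a) memv_ker ux. Qed.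

Lemma is_epiP M N (u : mor M N) :
  (forall a y, exists x, u a x = y) -> is_epi u.
Proof.
move=> us a; apply/eqP; rewrite eqEsubv subvf; apply/subvP => y _.
by have [x <-] := us a y; apply/memv_img/memvf.
Qed.

Lemma is_epi_ex M N (u : mor M N) a y : is_epi u -> exists x, u a x = y.
Proof.
by move=> us; have := memvf y; rewrite -(us a) => /memv_imgP[x _ ->]; exists x.
Qed.

Section Build.
Variables (M N : lfdMod A) (u : forall a, 'Hom(M a, N a)).
Hypothesis uN : forall a b (h : Hom A a b) x, mact N h (u a x) = u b (mact M h x).

Fact build_nat a b (h : Hom A a b) : (mact N h \o u a = u b \o mact M h)%VF.
Proof. by apply/lfunP => x; rewrite comp_lfunE [RHS]comp_lfunE. Qed.

Definition build_mor : mor M N := Mor build_nat.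

End Build.

Fact mor_comp_nat M N X (v : mor N X) (u : mor M N) a b (h : Hom A a b) x :
  mact X h ((v a \o u a)%VF x) = (v b \o u b)%VF (mact M h x).
Proof. by rewrite comp_lfunE [RHS]comp_lfunE !mnatE. Qed.

Definition mor_comp M N X (v : mor N X) (u : mor M N) : mor M X :=
  build_mor (mor_comp_nat v u).

Lemma mor_compE M N X (v : mor N X) (u : mor M N) a x :
  mor_comp v u a x = v a (u a x).
Proof. exact: comp_lfunE. Qed.

Section Submodule.
Variables (M : lfdMod A) (U : forall a, {vspace M a}).

Definition stable : Prop :=
  forall a b (h : Hom A a b) x, x \in U a -> mact M h x \in U b.

Hypothesis Ust : stable.

Definition sub_ob a : vectType k := subvs_of (U a).
Definition sub_incl a : 'Hom(sub_ob a, M a) := linfun vsval.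

Fact sub_inclE a x : sub_incl a x = vsval x.
Proof. exact: lfunE. Qed.

Definition sub_act a b (h : Hom A a b) : 'Hom(sub_ob a, sub_ob b) :=
  (linfun (vsproj (U b)) \o mact M h \o sub_incl a)%VF.

Fact vsval_sub_act a b (h : Hom A a b) x :
  vsval (sub_act h x) = mact M h (vsval x).
Proof.
by rewrite !comp_lfunE lfunE /= sub_inclE vsprojK //; apply/Ust/subvsP.
Qed.

Fact sub_act_linear a b : linear (@sub_act a b).
Proof.
move=> t h h'; apply/lfunP => x; apply: val_inj.
rewrite add_lfunE scale_lfunE /= vsval_sub_act mact_lin.
by rewrite -!vsval_sub_act -linearP.
Qed.

Fact sub_act1 a : sub_act (idm a) = \1%VF.
Proof.
by apply/lfunP => x; apply: val_inj; rewrite /= vsval_sub_act mact1 !id_lfunE.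
Qed.

Fact sub_actM a b c (h : Hom A b c) (h' : Hom A a b) :
  sub_act (comp h h') = (sub_act h \o sub_act h')%VF.
Proof.
apply/lfunP => x; apply: val_inj.
by rewrite comp_lfunE /= !vsval_sub_act mactME.
Qed.

Definition submod : lfdMod A := LfdMod sub_act_linear sub_act1 sub_actM.

Fact sub_incl_nat a b (h : Hom A a b) (x : submod a) :
  mact M h (sub_incl a x) = sub_incl b (mact submod h x).
Proof. by rewrite sub_inclE [RHS]sub_inclE vsval_sub_act. Qed.

Definition submod_incl : mor submod M := build_mor sub_incl_nat.

Lemma submod_inclE a x : submod_incl a x = vsval x.
Proof. exact: sub_inclE. Qed.

Section Corestriction.
Variables (X : lfdMod A) (u : mor X M) (uU : forall a x, u a x \in U a).

Let corestr a : 'Hom(X a, submod a) := (linfun (vsproj (U a)) \o u a)%VF.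

Fact corestrE a x : vsval (corestr a x) = u a x.
Proof. by rewrite comp_lfunE lfunE /= vsprojK ?uU. Qed.

Fact corestr_nat a b (h : Hom A a b) x :
  mact submod h (corestr a x) = corestr b (mact X h x).
Proof. by apply: val_inj; rewrite /= vsval_sub_act !corestrE mnatE. Qed.

Definition submod_corestr : mor X submod := build_mor corestr_nat.

Lemma submod_corestrE a x : vsval (submod_corestr a x) = u a x.
Proof. exact: corestrE. Qed.

End Corestriction.

(** The quotient space is represented by the complement of the subspace, and
    the projection of [x] onto it is [x - projv (U a) x]. *)
Definition quo_ob a : vectType k := subvs_of (U a)^C%VS.
Definition quo_pi a : 'Hom(M a, quo_ob a) :=
  (linfun (vsproj (U a)^C) \o (\1 - projv (U a)))%VF.

Fact vsval_quo_pi a x : vsval (quo_pi a x) = x - projv (U a) x.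
Proof.
rewrite comp_lfunE lfunE /= add_lfunE opp_lfunE id_lfunE vsprojK //.
exact: memv_projC.
Qed.

Lemma quo_pi_eq0 a x : (quo_pi a x == 0) = (x \in U a).
Proof.
apply/eqP/idP => [/(congr1 vsval)/=|xU].
  by rewrite vsval_quo_pi => /eqP; rewrite subr_eq0 => /eqP ->; apply: memv_proj.
by apply: val_inj; rewrite /= vsval_quo_pi projv_id // subrr.
Qed.

Fact quo_valK a (y : quo_ob a) : quo_pi a (vsval y) = y.
Proof.
apply: val_inj; rewrite /= vsval_quo_pi.
suff /eqP -> : projv (U a) (vsval y) == 0 by rewrite subr0.
rewrite -memv0 -(capv_compl (U a)) memv_cap memv_proj /=.
by rewrite -[X in X \in _](subKr (vsval y)) rpredB ?memv_projC ?subvsP.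
Qed.

Definition quo_act a b (h : Hom A a b) : 'Hom(quo_ob a, quo_ob b) :=
  (quo_pi b \o mact M h \o linfun vsval)%VF.

Fact quo_actE a b (h : Hom A a b) y : quo_act h y = quo_pi b (mact M h (vsval y)).
Proof.
rewrite [LHS]comp_lfunE [LHS]comp_lfunE.
by congr (quo_pi b (mact M h _)); apply: lfunE.
Qed.

Fact quo_act_pi a b (h : Hom A a b) x :
  quo_act h (quo_pi a x) = quo_pi b (mact M h x).
Proof.
rewrite quo_actE vsval_quo_pi linearB [LHS]linearB /=.
suff /eqP -> : quo_pi b (mact M h (projv (U a) x)) == 0 by rewrite subr0.
by rewrite quo_pi_eq0 Ust ?memv_proj.
Qed.

Fact quo_act_linear a b : linear (@quo_act a b).
Proof.
move=> t h h'; apply/lfunP => y.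
by rewrite add_lfunE scale_lfunE -[y]quo_valK !quo_act_pi mact_lin linearP.
Qed.

Fact quo_act1 a : quo_act (idm a) = \1%VF.
Proof.
by apply/lfunP => y; rewrite -[y]quo_valK quo_act_pi mact1 !id_lfunE.
Qed.

Fact quo_actM a b c (h : Hom A b c) (h' : Hom A a b) :
  quo_act (comp h h') = (quo_act h \o quo_act h')%VF.
Proof.
by apply/lfunP => y; rewrite comp_lfunE -[y]quo_valK !quo_act_pi mactME.
Qed.

Definition quomod : lfdMod A := LfdMod quo_act_linear quo_act1 quo_actM.

Definition quomod_pi : mor M quomod :=
  @build_mor M quomod quo_pi (fun a b h x => quo_act_pi h x).

Lemma quomod_pi_eq0 a x : (quomod_pi a x == 0) = (x \in U a).
Proof. exact: quo_pi_eq0. Qed.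

Lemma quomod_pi_surj a (y : quomod a) : exists x, quomod_pi a x = y.
Proof. by exists (vsval y); apply: quo_valK. Qed.

Section Factorization.
Variables (X : lfdMod A) (u : mor M X) (uU : forall a x, x \in U a -> u a x = 0).

Let fac a : 'Hom(quomod a, X a) := (u a \o linfun vsval)%VF.

Fact quo_fac_pi a x : fac a (quo_pi a x) = u a x.
Proof.
rewrite comp_lfunE lfunE /= vsval_quo_pi linearB /=.
by rewrite [u a (projv _ _)]uU ?subr0 ?memv_proj.
Qed.

Fact quo_fac_nat a b (h : Hom A a b) y :
  mact X h (fac a y) = fac b (mact quomod h y).
Proof.
rewrite -[y]quo_valK quo_fac_pi mnatE -quo_fac_pi.
by congr (fac b _); rewrite [RHS]quo_act_pi.
Qed.

Definition quomod_fac : mor quomod X := build_mor quo_fac_nat.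

Lemma quomod_facE a x : quomod_fac a (quomod_pi a x) = u a x.
Proof. exact: quo_fac_pi. Qed.

End Factorization.
End Submodule.
End ModuleConstructions.

(** * Modules generated or cogenerated by their values on finitely many objects *)

Section Generation.
Variables (k : fieldType) (A : homFinCat k).
Implicit Types (M N X Y : lfdMod A) (F s : list A).

(** Quantifying over the subspaces [W] of one value [M b] says that [M b] is
    spanned by the images of the [M a] with [a] in [F], without a formula for
    this span; it is dual to the common kernel in [cogenerated]. *)
Definition generated F M : Prop :=
  forall b (W : {vspace M b}),
    (forall a (h : Hom A a b) x, In a F -> mact M h x \in W) ->
  forall x, x \in W.

Definition cogenerated F M : Prop :=
  forall b (x : M b),
    (forall a (h : Hom A b a), In a F -> mact M h x = 0) -> x = 0.

Lemma generated_mor_eq F X Y (u v : mor X Y) : generated F X ->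
  (forall a x, In a F -> u a x = v a x) -> forall b x, u b x = v b x.
Proof.
move=> XF uv b x; apply/eqP; rewrite -subr_eq0.
have -> : u b x - v b x = (u b - v b) x by rewrite add_lfunE opp_lfunE.
rewrite -memv_ker; apply: XF => a h y aF.
by rewrite memv_ker add_lfunE opp_lfunE -!mnatE uv // subrr.
Qed.

Lemma cogenerated_mor_eq F X Y (u v : mor X Y) : cogenerated F Y ->
  (forall a x, In a F -> u a x = v a x) -> forall b x, u b x = v b x.
Proof.
move=> YF uv b x; apply/eqP; rewrite -subr_eq0; apply/eqP/YF => a h aF.
by rewrite linearB /= !mnatE uv // subrr.
Qed.

Section Hulls.
Variables (F : list A) (M : lfdMod A) (U : forall a, {vspace M a}).

Fact gen_ex b : exists W : {vspace M b}, forall x, x \in W <->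
  forall W' : {vspace M b},
    (forall a (h : Hom A a b) y, In a F -> y \in U a -> mact M h y \in W') ->
  x \in W'.
Proof.
apply: vspace_of_pred => [W' _ | t x y xW yW W' W'U]; first exact: mem0v.
by rewrite rpredD ?rpredZ ?xW ?yW.
Qed.

(** The submodule generated by the spaces [U a] with [a] in [F]. *)
Definition gen b : {vspace M b} := projT1 (cid (gen_ex b)).

Lemma genP b x : x \in gen b <-> forall W' : {vspace M b},
    (forall a (h : Hom A a b) y, In a F -> y \in U a -> mact M h y \in W') ->
  x \in W'.
Proof. exact: (projT2 (cid (gen_ex b))). Qed.

Lemma gen_stable : stable gen.
Proof.
move=> b c h x /genP xP; apply/genP => W WU.
rewrite memv_preim; apply: xP => a h' y aF yU.
by rewrite -memv_preim -mactME WU.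
Qed.

Lemma mem_gen a x : In a F -> x \in U a -> x \in gen a.
Proof.
move=> aF xU; apply/genP => W /(_ a (idm a) x aF xU).
by rewrite mact1 id_lfunE.
Qed.

Lemma gen_min : stable U -> forall b x, x \in gen b -> x \in U b.
Proof. by move=> Ust b x /genP; apply=> a h y _; apply: Ust. Qed.

Fact cog_ex b : exists W : {vspace M b}, forall x, x \in W <->
  forall a (h : Hom A b a), In a F -> mact M h x \in U a.
Proof.
apply: vspace_of_pred => [a h _ | t x y xW yW a h aF].
  by rewrite linear0 mem0v.
by rewrite linearP rpredD ?rpredZ ?xW ?yW.
Qed.

(** The largest submodule contained in [U a] for all [a] in [F]. *)
Definition cog b : {vspace M b} := projT1 (cid (cog_ex b)).

Lemma cogP b x : x \in cog b <->
  forall a (h : Hom A b a), In a F -> mact M h x \in U a.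
Proof. exact: (projT2 (cid (cog_ex b))). Qed.

Lemma cog_stable : stable cog.
Proof. by move=> b c h x /cogP xP; apply/cogP => a h' aF; rewrite -mactME xP. Qed.

Lemma cog_mem a x : In a F -> x \in cog a -> x \in U a.
Proof. by move=> aF /cogP /(_ a (idm a) aF); rewrite mact1 id_lfunE. Qed.

Lemma cog_max : stable U -> forall b x, x \in U b -> x \in cog b.
Proof. by move=> Ust b x xU; apply/cogP => a h _; apply: Ust. Qed.

End Hulls.

(** * Finite sums of representable modules and of their duals *)

(** A morphism [f : a -> b] is the image of the identity of [a] under the action
    of [f]. *)
Lemma proj_generated F a : In a F -> generated F (proj a).
Proof.
by move=> aF b W WF f; have := WF a f (idm a) aF; rewrite proj_actE compm1.
Qed.

(** The value of a functional [u] at [h : b -> a] is the value of [h u] at the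
    identity of [a]. *)
Lemma inj_cogenerated F a : In a F -> cogenerated F (inj a).
Proof.
move=> aF b u u0; apply/lfunP => h; rewrite zero_lfunE.
have /lfunP/(_ (idm a)) := u0 a h aF.
by rewrite inj_actE comp_lfunE precompE comp1m zero_lfunE.
Qed.

Lemma dsum_generated F X Y :
  generated F X -> generated F Y -> generated F (dsum X Y).
Proof.
move=> XF YF b W WF [x y].
pose iX : X b -> dsum X Y b := fun x => (x, 0).
pose iY : Y b -> dsum X Y b := fun y => (0, y).
have iXE : linfun iX =1 iX.
  by apply: linfunE_of => t v w; congr (_, _); rewrite /= ?scaler0 ?addr0.
have iYE : linfun iY =1 iY.
  by apply: linfunE_of => t v w; congr (_, _); rewrite /= ?scaler0 ?addr0.
have -> : (x, y) = iX x + iY y by congr (_, _); rewrite /= ?addr0 ?add0r.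
rewrite rpredD // -?iXE -?iYE memv_preim.
- apply: XF => a h z aF; rewrite -memv_preim iXE.
  by have := WF a h (z, 0) aF; rewrite dsum_actE /= linear0.
- apply: YF => a h z aF; rewrite -memv_preim iYE.
  by have := WF a h (0, z) aF; rewrite dsum_actE /= linear0.
Qed.

Lemma dsum_cogenerated F X Y :
  cogenerated F X -> cogenerated F Y -> cogenerated F (dsum X Y).
Proof.
move=> XF YF b [x y] xy0; congr (_, _).
- by apply: XF => a h aF; have := xy0 a h aF; rewrite dsum_actE => -[].
- by apply: YF => a h aF; have := xy0 a h aF; rewrite dsum_actE => -[].
Qed.

Lemma bigdsum_proj_generated F s :
  incl s F -> generated F (bigdsum (map (@proj _ A) s)).
Proof.
elim: s => [|a s IHs] sF /=.
  by move=> b W _ x; rewrite (_ : x = 0) ?mem0v //; apply/rowP => -[].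
apply: dsum_generated; first by apply/proj_generated/sF; left.
by apply: IHs => c cs; apply: sF; right.
Qed.

Lemma bigdsum_inj_cogenerated F s :
  incl s F -> cogenerated F (bigdsum (map (@inj _ A) s)).
Proof.
elim: s => [|a s IHs] sF /=; first by move=> b x _; apply/rowP => -[].
apply: dsum_cogenerated; first by apply/inj_cogenerated/sF; left.
by apply: IHs => c cs; apply: sF; right.
Qed.

Section Yoneda.
Variables (M : lfdMod A) (a : A).

Section Element.
Variable x : M a.

Let ev b : 'Hom(proj a b, M b) := linfun (fun f : Hom A a b => mact M f x).

Fact evE b f : ev b f = mact M f x.
Proof. by apply: linfunE_of => t h h'; rewrite mact_lin. Qed.

Fact ev_nat b c (h : Hom A b c) f : mact M h (ev b f) = ev c (mact (proj a) h f).
Proof. by rewrite !evE proj_actE mactME. Qed.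

Definition proj_mor : mor (proj a) M := build_mor ev_nat.

End Element.

Section Functional.
Variable phi : 'Hom(M a, k^o).

Let orb b (x : M b) : 'Hom(Hom A b a, M a) := linfun (fun h => mact M h x).

Fact orbE b x h : @orb b x h = mact M h x.
Proof. by apply: linfunE_of => t g g'; rewrite mact_lin. Qed.

Let coev b : 'Hom(M b, inj a b) := linfun (fun x => (phi \o orb x)%VF : dual _).

Fact coevE b x h : (coev b x : 'Hom(_, _)) h = phi (mact M h x).
Proof.
rewrite /coev linfunE_of ?comp_lfunE ?orbE // => t y z; apply/lfunP => g.
by rewrite add_lfunE scale_lfunE !comp_lfunE !orbE !linearP.
Qed.

Fact coev_nat b c (h : Hom A b c) x :
  mact (inj a) h (coev b x) = coev c (mact M h x).
Proof.
by apply/lfunP => g; rewrite coevE inj_actE comp_lfunE precompE coevE mactME.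
Qed.

Definition inj_mor : mor M (inj a) := build_mor coev_nat.

Lemma inj_mor_id x : inj_mor a x = 0 -> phi x = 0.
Proof.
by move=> /lfunP/(_ (idm a)); rewrite coevE mact1 id_lfunE zero_lfunE.
Qed.

End Functional.

Lemma proj_mor_id x : proj_mor x a (idm a) = x.
Proof. by rewrite evE mact1 id_lfunE. Qed.

End Yoneda.

Section Pairings.
Variables X Y Z : lfdMod A.

Section Copairing.
Variables (u : mor X Z) (v : mor Y Z).

Let cop a : 'Hom(dsum X Y a, Z a) :=
  linfun (fun z : dsum_ob X Y a => u a z.1 + v a z.2).

Fact copE a z : cop a z = u a z.1 + v a z.2.
Proof.
by apply: linfunE_of => t y y'; rewrite /= !linearP scalerDr addrACA.
Qed.

Fact cop_nat a b (h : Hom A a b) z :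
  mact Z h (cop a z) = cop b (mact (dsum X Y) h z).
Proof. by rewrite !copE dsum_actE linearD /= !mnatE. Qed.

Definition copairing : mor (dsum X Y) Z := build_mor cop_nat.

Lemma copairingE a x y : copairing a (x, y) = u a x + v a y.
Proof. exact: copE. Qed.

End Copairing.

Section Pairing.
Variables (u : mor Z X) (v : mor Z Y).

Let pai a : 'Hom(Z a, dsum X Y a) := linfun (fun z => (u a z, v a z) : dsum_ob X Y a).

Fact paiE a z : pai a z = (u a z, v a z).
Proof.
by apply: (@linfunE_of _ _ (dsum_ob X Y a)) => t y y'; rewrite !linearP.
Qed.

Fact pai_nat a b (h : Hom A a b) z :
  mact (dsum X Y) h (pai a z) = pai b (mact Z h z).
Proof. by rewrite !paiE dsum_actE /= !mnatE. Qed.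

Definition pairing : mor Z (dsum X Y) := build_mor pai_nat.

Lemma pairingE a z : pairing a z = (u a z, v a z).
Proof. exact: paiE. Qed.

End Pairing.
End Pairings.

Fact zero_mor_nat X Y a b (h : Hom A a b) x :
  mact Y h ((0 : 'Hom(X a, Y a)) x) = (0 : 'Hom(X b, Y b)) (mact X h x).
Proof. by rewrite !zero_lfunE linear0. Qed.

Definition zero_mor X Y : mor X Y := build_mor (@zero_mor_nat X Y).

Lemma mem_In (T : eqType) (x : T) (l : list T) : x \in l -> In x l.
Proof.
by elim: l => //= y l IHl; rewrite inE => /orP[/eqP -> | /IHl]; [left | right].
Qed.

(** By the Yoneda lemma each element of [M a] is hit by a morphism [P_a -> M];
    repeated objects in the list account for multiplicities. *)
Lemma proj_cover_elements M (l : list {a & M a}) :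
  exists p : mor (bigdsum (map (@proj _ A) (map (@projT1 _ _) l))) M,
    forall q, In q l -> exists z, p (projT1 q) z = projT2 q.
Proof.
elim: l => [|[a x] l [p pP]] /=; first by exists (zero_mor _ _).
exists (copairing (proj_mor x) p) => q [<- | /pP[z pz]].
  by exists (idm a, 0); rewrite [LHS]copairingE proj_mor_id linear0 addr0.
by exists (0, z); rewrite [LHS]copairingE linear0 add0r.
Qed.

(** Dually, each functional on [M a] factors through a morphism [M -> I_a]. *)
Lemma inj_cover_functionals M (l : list {a & 'Hom(M a, k^o)}) :
  exists i : mor M (bigdsum (map (@inj _ A) (map (@projT1 _ _) l))),
    forall q, In q l -> forall x, i (projT1 q) x = 0 -> projT2 q x = 0.
Proof.
elim: l => [|[a phi] l [i iP]] /=; first by exists (zero_mor _ _).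
exists (pairing (inj_mor phi) i) => q [<- | ql] x.
  by rewrite pairingE => -[/inj_mor_id].
by rewrite pairingE => -[_]; apply: iP.
Qed.

(** The elements to be hit are the vectors of bases of the [M a], [a] in [F]. *)
Lemma generated_cover F M : generated F M ->
  exists s, incl s F /\
    exists p : mor (bigdsum (map (@proj _ A) s)) M, is_epi p.
Proof.
move=> MF.
pose l :=
  flat_map (fun a => map (existT (fun a => M a : Type) a) (vbasis {:M a})) F.
have [p pP] := proj_cover_elements l.
exists (map (@projT1 _ _) l); split.
  by move=> a /in_map_iff[_ [<- /in_flat_map[b [bF /in_map_iff[x [<- _]]]]]].
exists p => b; apply/eqP; rewrite eqEsubv subvf; apply/subvP => y _.
apply: MF => a h x aF.
have [z <-] : exists z, p a z = x.
  have : x \in limg (p a).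
    suff /subvP : (fullv <= limg (p a))%VS by apply; apply: memvf.
    rewrite -(span_basis (vbasisP {:M a})); apply/span_subvP => e el.
    have [|z /= <-] := pP (existT _ a e); last exact/memv_img/memvf.
    by apply/in_flat_map; exists a; split=> //; apply/in_map/mem_In.
  by move=> /memv_imgP[z _ ->]; exists z.
by rewrite mnatE; apply/memv_img/memvf.
Qed.

(** The coordinate functionals of the [M a] with [a] in [F] separate the
    elements of these spaces, and [cogenerated] extends this to all objects. *)
Lemma cogenerated_cover F M : cogenerated F M ->
  exists s, incl s F /\
    exists i : mor M (bigdsum (map (@inj _ A) s)), is_mono i.
Proof.
move=> MF; pose V := fun a => 'Hom(M a, k^o).
pose crd a j : V a := linfun (fun x => coord (vbasis {:M a}) j x : k^o).
have crdE a j x : crd a j x = coord (vbasis {:M a}) j x.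
  by apply: linfunE_of => t y z; rewrite linearP.
pose l := flat_map (fun a =>
  map (fun j => existT V a (crd a j)) (enum 'I_(\dim {:M a}))) F.
have [i iP] := inj_cover_functionals l.
exists (map (@projT1 _ _) l); split.
  by move=> a /in_map_iff[_ [<- /in_flat_map[b [bF /in_map_iff[j [<- _]]]]]].
exists i; apply: is_monoP => b x ix0; apply: MF => a h aF.
rewrite [LHS](coord_vbasis (memvf _)) big1 // => j _.
suff -> : coord (vbasis {:M a}) j (mact M h x) = 0 by rewrite scale0r.
have jl : In (existT V a (crd a j)) l.
  apply/in_flat_map; exists a; split=> //.
  by apply/in_map_iff; exists j; split=> //; apply/mem_In; rewrite mem_enum.
have := iP _ jl (mact M h x) _; rewrite /= crdE; apply.
by rewrite -mnatE ix0 linear0.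
Qed.

End Generation.

(** * Modules detected on finitely many objects *)

Section Detection.
Variables (k : fieldType) (A : homFinCat k).
Implicit Types (L M N X Y : lfdMod A) (F : list A).

Definition bijective_on F X Y (u : mor X Y) : Prop :=
  forall a, In a F ->
    (forall x, u a x = 0 -> x = 0) /\ (forall y, exists x, u a x = y).

Lemma bijective_on_inv F X Y (u : mor X Y) a : bijective_on F u -> In a F ->
  cancel (u a) (u a)^-1%VF /\ cancel (u a)^-1%VF (u a).
Proof.
move=> uF aF; have [u0 us] := uF a aF.
have uK : cancel (u a) (u a)^-1%VF.
  apply/lker0_lfunK; rewrite -subv0; apply/subvP => x.
  by rewrite memv_ker memv0 => /eqP/u0 ->.
by split=> // y; have [x <-] := us y; rewrite uK.
Qed.

(** The inclusion of the submodule generated by the values on [F] is bijective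
    on [F], and an inclusion that is a retraction is onto. *)
Lemma generated_of_detected F N :
    (forall X (u : mor X N), bijective_on F u -> is_retraction u) ->
  generated F N.
Proof.
move=> NF b W WF x.
pose U := gen F (fun a => {:N a}%VS).
have Ust : stable U := @gen_stable _ _ F N _.
have [|s sP] := NF _ (submod_incl Ust).
  move=> a aF; split=> [y | y].
    by rewrite submod_inclE => y0; apply: val_inj.
  exists (vsproj (U a) y); rewrite submod_inclE vsprojK //.
  by apply: mem_gen; rewrite ?memvf.
have xU : x \in U b.
  have /lfunP/(_ x) := sP b; rewrite comp_lfunE submod_inclE id_lfunE => <-.
  exact: subvsP.
by move: xU => /genP; apply=> a h y aF _; apply: WF.
Qed.

(** The projection onto the quotient by the largest submodule vanishing on [F]
    is bijective on [F], and a section is injective. *)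
Lemma cogenerated_of_detected F L :
    (forall X (u : mor L X), bijective_on F u -> is_section u) ->
  cogenerated F L.
Proof.
move=> LF b x xF.
pose U := cog F (fun a => 0%VS : {vspace L a}).
have Ust : stable U := @cog_stable _ _ F L _.
have [|r rP] := LF _ (quomod_pi Ust).
  move=> a aF; split; last exact: quomod_pi_surj.
  move=> y /eqP; rewrite quomod_pi_eq0 => /(cog_mem aF).
  by rewrite memv0 => /eqP.
have /lfunP/(_ x) := rP b; rewrite comp_lfunE id_lfunE => <-.
have /eqP -> : quomod_pi Ust b x == 0; last by rewrite linear0.
by rewrite quomod_pi_eq0; apply/cogP => a h aF; rewrite xF // mem0v.
Qed.

Lemma ker_stable X Y (u : mor X Y) : stable (fun a => lker (u a)).
Proof.
by move=> a b h x; rewrite !memv_ker -mnatE => /eqP ->; rewrite linear0.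
Qed.

Lemma img_stable X Y (u : mor X Y) : stable (fun a => limg (u a)).
Proof.
by move=> a b h y /memv_imgP[x _ ->]; rewrite mnatE; apply/memv_img/memvf.
Qed.

(** The kernel of a cover [p : P -> N] is generated by its values on [F]: the
    quotient of [P] by the submodule [K'] that these generate maps bijectively
    to [N] on [F], so the map splits, and it is injective because [P] is
    generated by its values on [F]. *)
Lemma finitely_presented_of_detected F N :
    (forall X (u : mor X N), bijective_on F u -> is_retraction u) ->
  finitely_presented N.
Proof.
move=> NF; have [s [sF [p p_epi]]] := generated_cover (generated_of_detected NF).
have PF := bigdsum_proj_generated sF; set P := bigdsum _ in p p_epi PF *.
pose K := fun a => lker (p a); have Kst : stable K := @ker_stable _ _ p.
pose K' := gen F K; have K'st : stable K' := @gen_stable _ _ F P _.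
have pK' a x : x \in K' a -> p a x = 0.
  by move=> /(gen_min Kst); rewrite memv_ker => /eqP.
pose pbar := quomod_fac K'st pK'.
have pbarF : bijective_on F pbar.
  move=> a aF; split=> [y | y].
    have [x <-] := quomod_pi_surj y; rewrite quomod_facE => px0.
    by apply/eqP; rewrite quomod_pi_eq0; apply: mem_gen; rewrite // memv_ker px0.
  have [x <-] := is_epi_ex y p_epi.
  by exists (quomod_pi K'st a x); rewrite quomod_facE.
have [r rP] := NF _ pbar pbarF.
have rK a y : pbar a (r a y) = y.
  by have /lfunP/(_ y) := rP a; rewrite comp_lfunE id_lfunE.
(* On [F] both sides have the same image under the injective map [pbar]. *)
have pi_eq b x : quomod_pi K'st b x = r b (p b x).
  rewrite -mor_compE; apply: (generated_mor_eq PF) => a {}x aF.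
  have [pbarK _] := bijective_on_inv pbarF aF.
  by apply: (can_inj pbarK); rewrite mor_compE rK quomod_facE.
have KF : generated F (submod Kst).
  move=> b W WF x.
  suff /memv_imgP[y yW exy] : vsval x \in (submod_incl Kst b @: W)%VS.
    by rewrite (_ : x = y) //; apply: val_inj; rewrite /= exy submod_inclE.
  have : vsval x \in K' b.
    rewrite -(quomod_pi_eq0 K'st) pi_eq.
    by have := subvsP x; rewrite memv_ker => /eqP ->; rewrite linear0.
  move=> /genP; apply=> a h y aF yK.
  apply/memv_imgP; exists (mact (submod Kst) h (vsproj (K a) y)); first exact: WF.
  by rewrite -mnatE submod_inclE vsprojK.
have [s' [_ fgK]] := generated_cover KF.
exists s, p, (submod Kst), (submod_incl Kst); split; last by exists s'.
split=> // [|a].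
  by apply: is_monoP => a x; rewrite submod_inclE => x0; apply: val_inj.
apply/vspaceP => x; apply/memv_imgP/idP => [[y _ ->] | xK].
  by rewrite submod_inclE; apply: subvsP.
by exists (vsproj (K a) x); rewrite ?memvf ?submod_inclE ?vsprojK.
Qed.

(** Dually, let [U'] be the largest submodule of [I] that agrees with the image
    of [i : L -> I] on [F]. Then [L -> U'] has a retraction [r], and the
    inclusion of [U'] equals [i r] because [I] is cogenerated by its values on
    [F]. So [U'] is the image of [i], which says that the cokernel of [i] is
    cogenerated by its values on [F]. *)
Lemma finitely_copresented_of_detected F L :
    (forall X (u : mor L X), bijective_on F u -> is_section u) ->
  finitely_copresented L.
Proof.
move=> LF; have [s [sF [i i_mono]]] := cogenerated_cover (cogenerated_of_detected LF).
have IF := bigdsum_inj_cogenerated sF; set I := bigdsum _ in i i_mono IF *.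
pose U := fun a => limg (i a); have Ust : stable U := @img_stable _ _ i.
pose U' := cog F U; have U'st : stable U' := @cog_stable _ _ F I _.
have iU a x : i a x \in U a by apply/memv_img/memvf.
have iU' a x : i a x \in U' a by apply/(cog_max F Ust)/iU.
pose u := submod_corestr U'st iU'.
have uF : bijective_on F u.
  move=> a aF; split=> [x ux0 | y].
    by apply: (is_mono_eq0 i_mono); rewrite -(submod_corestrE U'st iU') ux0.
  have /(cog_mem aF)/memv_imgP[x _ exy] := subvsP y.
  exists x; apply: val_inj; apply: etrans (esym exy).
  exact: submod_corestrE.
have [r rP] := LF _ u uF.
have rK a x : r a (u a x) = x.
  by have /lfunP/(_ x) := rP a; rewrite comp_lfunE id_lfunE.
have incl_eq b y : submod_incl U'st b y = i b (r b y).
  rewrite -mor_compE; apply: (cogenerated_mor_eq IF) => a {}y aF.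
  have [x <-] := (uF a aF).2 y.
  by rewrite mor_compE rK submod_inclE submod_corestrE.
have U'U b x : x \in U' b -> x \in U b.
  by move=> xU'; rewrite -(vsprojK xU') -(@submod_inclE _ _ _ _ U'st) incl_eq iU.
have CF : cogenerated F (quomod Ust).
  move=> b y yF; have [x exy] := quomod_pi_surj y.
  rewrite -exy; apply/eqP; rewrite quomod_pi_eq0; apply/U'U/cogP => a h aF.
  by rewrite -(quomod_pi_eq0 Ust) -mnatE exy yF.
have [s' [_ fcC]] := cogenerated_cover CF.
exists s, i, (quomod Ust), (quomod_pi Ust); split; last by exists s'.
split=> // [a|].
  by apply/vspaceP => x; rewrite memv_ker quomod_pi_eq0.
by apply: is_epiP => a y; apply: quomod_pi_surj.
Qed.

(** * Detection of almost split sequences *)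

(** Naturality at one morphism and the condition at one object are affine and
    involve at most two objects, so compactness applies. *)
Lemma local_morphisms_glue X Y (Q : forall a, 'Hom(X a, Y a) -> Prop) :
    (forall a, affine (@Q a)) ->
    (forall F, exists x : forall a, 'Hom(X a, Y a),
       (forall a, In a F -> Q a (x a)) /\
       (forall a b (h : Hom A a b) z, In a F -> In b F ->
          mact Y h (x a z) = x b (mact X h z))) ->
  exists u : mor X Y, forall a, Q a (u a).
Proof.
move=> Qaff loc.
pose P F (x : forall a, 'Hom(X a, Y a)) :=
  (forall a, In a F -> Q a (x a)) /\
  (forall a b (h : Hom A a b) z, In a F -> In b F ->
     mact Y h (x a z) = x b (mact X h z)).
have [|||x xP] := @affine_compactness k A (fun a => 'Hom(X a, Y a)) P _ _ _ loc.
- move=> F x y z t [Qx nx] [Qy ny] [Qz nz]; split=> [a aF | a b h w aF bF].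
    by apply: Qaff; [apply: Qx | apply: Qy | apply: Qz].
  rewrite !(add_lfunE, scale_lfunE, opp_lfunE) linearD linearZ linearB /=.
  by rewrite nx // ny // nz.
- move=> F x y xy [Qx nx]; split=> [a aF | a b h w aF bF].
    by rewrite -xy //; apply: Qx.
  by rewrite -!xy // nx.
- move=> F G x FG [Qx nx]; split=> [a /FG | a b h w /FG aG /FG bG]; first exact: Qx.
  exact: nx.
have nat a b (h : Hom A a b) z : mact Y h (x a z) = x b (mact X h z).
  by apply: (xP [:: a; b]).2 => /=; auto.
by exists (build_mor nat) => a; apply: (xP [:: a]).1 => /=; auto.
Qed.

(** If a module [X] that is not split over [N] existed for each finite [F], then
    its lifting to [M], composed with the inverse of [u] on [F], would give a
    section of [g] over [F]; these sections glue to a section of [g]. *)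
Lemma retraction_detected M N (g : mor M N) : ~ is_retraction g ->
    (forall X (u : mor X N), ~ is_retraction u ->
       exists v : mor X M, forall a, u a = (g a \o v a)%VF) ->
  exists F, forall X (u : mor X N), bijective_on F u -> is_retraction u.
Proof.
move=> gNr lift; apply: contrapT => noF; apply: gNr.
apply: (@local_morphisms_glue N M (fun a v => (g a \o v)%VF = \1%VF)).
  move=> a x y z t gx gy gz.
  rewrite comp_lfunDr -comp_lfunZr comp_lfunDr comp_lfunNr gx gy gz.
  by rewrite subrr scaler0 addr0.
move=> F; apply: contrapT => noloc; apply: noF; exists F => X u uF.
apply: contrapT => uNr; have [v uv] := lift X u uNr; apply: noloc.
(* [(u a)^-1] is a total linear map, an inverse of [u a] only for [a] in [F];
   the conditions concern no other object. *)
exists (fun a => v a \o (u a)^-1)%VF; split=> [a aF | a b h z aF bF].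
  apply/lfunP => y; rewrite comp_lfunA -uv comp_lfunE id_lfunE.
  by have [_ ->] := bijective_on_inv uF aF.
rewrite !comp_lfunE mnatE; congr (v b _).
have [_ uVa] := bijective_on_inv uF aF; have [uVb _] := bijective_on_inv uF bF.
by rewrite -{2}[z]uVa mnatE uVb.
Qed.

Lemma section_detected L M (f : mor L M) : ~ is_section f ->
    (forall X (u : mor L X), ~ is_section u ->
       exists v : mor M X, forall a, u a = (v a \o f a)%VF) ->
  exists F, forall X (u : mor L X), bijective_on F u -> is_section u.
Proof.
move=> fNs lift; apply: contrapT => noF; apply: fNs.
apply: (@local_morphisms_glue M L (fun a v => (v \o f a)%VF = \1%VF)).
  move=> a x y z t xf yf zf.
  rewrite comp_lfunDl -comp_lfunZl comp_lfunDl comp_lfunNl xf yf zf.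
  by rewrite subrr scaler0 addr0.
move=> F; apply: contrapT => noloc; apply: noF; exists F => X u uF.
apply: contrapT => uNs; have [v uv] := lift X u uNs; apply: noloc.
exists (fun a => (u a)^-1 \o v a)%VF; split=> [a aF | a b h z aF bF].
  apply/lfunP => y; rewrite -comp_lfunA -uv comp_lfunE id_lfunE.
  by have [-> _] := bijective_on_inv uF aF.
have [_ uVa] := bijective_on_inv uF aF; have [uVb _] := bijective_on_inv uF bF.
by rewrite !comp_lfunE -mnatE -{2}[v a z]uVa mnatE uVb.
Qed.

(** A retraction [r] of [f] makes [1 - f r] vanish on the image of [f], so it
    factors through [g], and the factor is a section of [g]. *)
Lemma section_retraction L M N (f : mor L M) (g : mor M N) :
  short_exact f g -> is_section f -> is_retraction g.
Proof.
move=> [_ fg g_epi] [r rf].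
have rK a x : r a (f a x) = x.
  by have /lfunP/(_ x) := rf a; rewrite comp_lfunE id_lfunE.
have fg0 a x : g a (f a x) = 0.
  by apply/eqP; rewrite -memv_ker -fg; apply/memv_img/memvf.
have gV a : cancel (g a)^-1%VF (g a).
  by move=> y; apply: limg_lfunVK; rewrite g_epi memvf.
pose e a := (\1 - (f a \o r a))%VF.
have eE a x : e a x = x - f a (r a x).
  by rewrite add_lfunE opp_lfunE id_lfunE comp_lfunE.
have eg a x y : g a x = g a y -> e a x = e a y.
  move=> gxy; have : x - y \in limg (f a).
    by rewrite fg memv_ker linearB /= gxy subrr.
  move=> /memv_imgP[z _ xy]; apply/eqP; rewrite -subr_eq0 -linearB /= xy.
  by rewrite eE rK subrr.
have sN a b (h : Hom A a b) y :
    mact M h ((e a \o (g a)^-1)%VF y) = (e b \o (g b)^-1)%VF (mact N h y).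
  rewrite comp_lfunE [RHS]comp_lfunE.
  have -> : e b ((g b)^-1%VF (mact N h y)) = e b (mact M h ((g a)^-1%VF y)).
    by apply: eg; rewrite gV -mnatE gV.
  by rewrite !eE linearB /= !mnatE.
exists (build_mor sN) => a; apply/lfunP => y.
by rewrite comp_lfunE comp_lfunE eE linearB /= fg0 subr0 gV id_lfunE.
Qed.

End Detection.

Theorem theorem4p1 (k : closedFieldType) (A : spectroid k)
    (L M N : lfdMod A) (f : mor L M) (g : mor M N)
    (fg_almost_split : almost_split f g) :
  finitely_copresented L /\ finitely_presented N.
Proof.
have [fg gNr _ liftL liftN] := fg_almost_split; split.
  have fNs : ~ is_section f by move=> /(section_retraction fg).
  have [F FP] := section_detected fNs liftL.
  exact: finitely_copresented_of_detected FP.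
have [F FP] := retraction_detected gNr liftN.
exact: finitely_presented_of_detected FP.
Qed.
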